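(* Let $n\ge 1$, let $\Lambda=\mathrm{diag}(\lambda_1,\dots,\lambda_n)$ with $0<\mu:=\lambda_1\le\lambda_2\le\cdots\le\lambda_n=:L$, let $\alpha_0>0$, and let $\xi_0\in\mathbb{R}^n$ satisfy $\xi_0^i\neq 0$ for all $i=1,\dots,n$. Let $(\xi_k)$ be generated by $\xi_{k+1}=(I-\alpha_k\Lambda)\xi_k$ for $k\ge 0$, where for $k\ge 1$ the stepsize is given by the AdOGD law $$\alpha_k=\frac{2}{\hat\mu_k+\hat L_k}.$$ Then $$\lim_{k\to+\infty}\alpha_k=\alpha^*:=\frac{2}{L+\mu}.$$
   Context: The iteration is gradient descent for the quadratic problem $\min_{\xi\in\mathbb{R}^n} f(\xi)=\frac12\xi^\top\Lambda\xi$, with $\nabla f(\xi)=\Lambda\xi$; $\xi_k^i$ denotes the $i$-th component of $\xi_k$. The local curvature estimate is, for $k\ge 1$ (with $\xi_k\ne\xi_{k-1}$), $$L_k=\frac{\|\nabla f(\xi_k)-\nabla f(\xi_{k-1})\|}{\|\xi_k-\xi_{k-1}\|}=\frac{\|\Lambda(\xi_k-\xi_{k-1})\|}{\|\xi_k-\xi_{k-1}\|},$$ where $\|\cdot\|$ is the Euclidean norm. The running estimators are $\hat L_1=\hat\mu_1=L_1$ and, for $k\ge 2$, $\hat L_k=\max\{\hat L_{k-1},L_k\}$ and $\hat\mu_k=\min\{\hat\mu_{k-1},L_k\}$. The initial stepsize $\alpha_0$ is used to compute $\xi_1$ from $\xi_0$.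
   Formalization: When μ<L, α_0 is assumed different from 1/μ and 1/L (the claim fails otherwise, e.g. Λ=diag(1,2), ξ_0=(1,1), α_0=1); if ξ_k=ξ_{k-1}, where L_k is undefined, the estimators are kept unchanged. *)

(* Defs.v *)
From mathcomp Require Import all_boot all_order all_algebra.
From mathcomp Require Import all_classical all_reals all_analysis.

Set Implicit Arguments.
Unset Strict Implicit.
Unset Printing Implicit Defensive.

Import Order.TTheory GRing.Theory Num.Theory.
Import numFieldNormedType.Exports.

Local Open Scope ring_scope.

(* The library norm `|x| on matrices is the sup norm, hence this definition. *)
Definition enorm (R : realType) (n : nat) (x : 'cV[R]_n) : R :=
  Num.sqrt (\sum_(i < n) x i 0 ^+ 2).

(* Gradient of f(x) = 1/2 x^T Lam x for symmetric Lam. *)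
Definition quad_grad (R : realType) (n : nat) (Lam : 'M[R]_n)
    (x : 'cV[R]_n) : 'cV[R]_n := Lam *m x.

(* Only meaningful for k >= 1 and xi k != xi k.-1. *)
Definition local_curv (R : realType) (n : nat) (Lam : 'M[R]_n)
    (xi : nat -> 'cV[R]_n) (k : nat) : R :=
  enorm (quad_grad Lam (xi k) - quad_grad Lam (xi k.-1))
    / enorm (xi k - xi k.-1).

(* Running estimators, for k >= 1; the value at k = 0 is irrelevant.  If
   xi k = xi k.-1 then local_curv is 0 / 0: no curvature is observed at step k
   and the estimators are left unchanged (for gradient descent with a positive
   stepsize this happens only once the minimizer 0 has been reached exactly). *)
Fixpoint Lhat (R : realType) (n : nat) (Lam : 'M[R]_n)
    (xi : nat -> 'cV[R]_n) (k : nat) : R :=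
  match k with
  | (_.+1 as k1).+1 =>
      if xi k == xi k1 then Lhat Lam xi k1
      else Num.max (Lhat Lam xi k1) (local_curv Lam xi k)
  | _ => local_curv Lam xi 1
  end.

Fixpoint muhat (R : realType) (n : nat) (Lam : 'M[R]_n)
    (xi : nat -> 'cV[R]_n) (k : nat) : R :=
  match k with
  | (_.+1 as k1).+1 =>
      if xi k == xi k1 then muhat Lam xi k1
      else Num.min (muhat Lam xi k1) (local_curv Lam xi k)
  | _ => local_curv Lam xi 1
  end.

(* Main.v *)
(* The curvature estimate L_k is a weighted quadratic mean of the eigenvalues,
   weighted by the squared coordinates of xi_k - xi_(k-1); hence
   mu <= muhat_k <= L_1 <= Lhat_k <= L.  The estimators are monotone, with limits
   m and M, so alpha_k tends to a = 2 / (m + M).  When mu < L, the inequalities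
   mu < L_1 < L and the genericity of alpha_0 keep the extreme coordinates of
   xi_k nonzero.  If m + M > L + mu, then 1 - a mu has the strictly largest
   modulus among the limiting contraction factors, so the mu-eigenspace dominates
   the displacement and L_k tends to mu; thus m = mu and M > L, a contradiction.
   Symmetrically, m + M < L + mu would force L_k to tend to L, so M = L and
   m < mu. *)
Require Import Defs.
From mathcomp Require Import all_boot all_order all_algebra.
From mathcomp Require Import all_classical all_reals all_analysis.
From mathcomp Require Import ring lra.

Import Order.TTheory GRing.Theory Num.Theory.
Import numFieldNormedType.Exports.

Local Open Scope classical_set_scope.
Local Open Scope ring_scope.

(** Any [rho] strictly between [|l|] and 1 eventually bounds [|q k|], so a tail of [r] is dominated
    by a geometric sequence. *)
Lemma cvg0_ratio (R : realType) (r q : nat -> R) (l : R) :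
  (forall k, r k.+1 = q k * r k) -> q k @[k --> \oo] --> l -> `|l| < 1 ->
  r k @[k --> \oo] --> (0 : R).
Proof.
move=> rS ql l1.
have [rho /andP[l_rho rho1]] : exists rho, `|l| < rho < 1.
  by exists ((`|l| + 1) / 2); apply/andP; split; lra.
have rho0 : 0 <= rho by apply: le_trans (ltW l_rho).
have /= := cvgr_lt (`|l|) (cvg_norm ql) _ l_rho.
case=> N _ qN.
have rN k : `|r (k + N)%N| <= rho ^+ k * `|r N|.
  elim: k => [|k IH]; first by rewrite expr0 mul1r.
  rewrite addSn rS normrM exprS -mulrA ler_pM //.
  by apply/ltW/qN => /=; rewrite leq_addl.
rewrite -(cvg_shiftn N); apply/norm_cvg0P.
apply: (@squeeze_cvgr _ _ _ _ (cst 0) (fun k => rho ^+ k * `|r N|)).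
- by apply: nearW => k; rewrite rN normr_ge0.
- exact: cvg_cst.
- rewrite -[X in _ --> X](mul0r `|r N|); apply: cvgMr_tmp.
  by apply: cvg_expr; rewrite ger0_norm.
Qed.

(** * Weighted quadratic means of the eigenvalues *)

Section SpectralQuotient.
Set Implicit Arguments.
Unset Strict Implicit.
Variables (R : realType) (n : nat) (lambda : 'rV[R]_n).
Implicit Types d : 'cV[R]_n.

Definition spectral_quotient d := enorm (diag_mx lambda *m d) / enorm d.

Lemma sqr_enorm d : enorm d ^+ 2 = \sum_(i < n) d i 0 ^+ 2.
Proof. by rewrite sqr_sqrtr // sumr_ge0 // => i _; rewrite sqr_ge0. Qed.

Lemma enorm_gt0 d : d != 0 -> 0 < enorm d.
Proof.
move=> d0; rewrite sqrtr_gt0 lt0r sumr_ge0 ?andbT; last first.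
  by move=> i _; rewrite sqr_ge0.
apply: contra d0 => /eqP s0; apply/eqP/matrixP => i j; rewrite ord1 mxE.
have /psumr_eq0P/(_ i isT)/eqP : \sum_(i < n) d i 0 ^+ 2 = 0 by [].
by rewrite sqrf_eq0 => H; apply/eqP/H => ? _; rewrite sqr_ge0.
Qed.

Lemma spectral_quotient_ge0 d : 0 <= spectral_quotient d.
Proof. by rewrite divr_ge0 // sqrtr_ge0. Qed.

(** With the denominator cleared, comparing the quotient with [c] becomes a sign question, settled
    term by term from [lambda 0 i ^+ 2 - c ^+ 2]; the bounds below all rest on this. *)
Lemma spectral_quotient_sqrB d (c : R) : d != 0 ->
  (spectral_quotient d ^+ 2 - c ^+ 2) * enorm d ^+ 2 =
  \sum_(i < n) (lambda 0 i ^+ 2 - c ^+ 2) * d i 0 ^+ 2.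
Proof.
move=> /enorm_gt0 d0.
rewrite mulrBl -exprMn divfK ?gt_eqF // !sqr_enorm mulr_sumr -sumrB.
by apply: eq_bigr => i _; rewrite mul_diag_mx mxE; ring.
Qed.

Lemma spectral_quotient_ge d (c : R) : d != 0 -> 0 <= c ->
  (forall i, c <= lambda 0 i) -> c <= spectral_quotient d.
Proof.
move=> d0 c0 cl; rewrite -(@ler_sqr _ c) ?nnegrE ?spectral_quotient_ge0 //.
rewrite -subr_ge0 -(pmulr_lge0 _ (exprn_gt0 2 (enorm_gt0 d0))).
rewrite spectral_quotient_sqrB // sumr_ge0 // => i _.
by rewrite mulr_ge0 ?sqr_ge0 // subr_ge0 ler_sqr ?nnegrE // (le_trans c0).
Qed.

Lemma spectral_quotient_le d (c : R) : d != 0 ->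
  (forall i, 0 <= lambda 0 i <= c) -> 0 <= c -> spectral_quotient d <= c.
Proof.
move=> d0 cl c0; rewrite -(@ler_sqr _ _ c) ?nnegrE ?spectral_quotient_ge0 //.
rewrite -subr_le0 -(pmulr_lle0 _ (exprn_gt0 2 (enorm_gt0 d0))).
rewrite spectral_quotient_sqrB // sumr_le0 // => i _.
have /andP[l0 lc] := cl i.
by rewrite mulr_le0_ge0 ?sqr_ge0 // subr_le0 ler_sqr ?nnegrE.
Qed.

Lemma spectral_quotient_gt d (c : R) p : 0 <= c ->
  (forall i, c <= lambda 0 i) -> c < lambda 0 p -> d p 0 != 0 ->
  c < spectral_quotient d.
Proof.
move=> c0 cl clp dp.
have d0 : d != 0 by apply: contra_neq dp => ->; rewrite mxE.
rewrite -(@ltr_sqr _ c) ?nnegrE ?spectral_quotient_ge0 //.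
rewrite -subr_gt0 -(pmulr_lgt0 _ (exprn_gt0 2 (enorm_gt0 d0))).
rewrite spectral_quotient_sqrB // (bigD1 p) //= ltr_pwDl //.
  rewrite mulr_gt0 ?subr_gt0 ?lt0r ?sqrf_eq0 ?dp ?sqr_ge0 //.
  by rewrite ltr_sqr ?nnegrE // (le_trans c0).
rewrite sumr_ge0 // => i _.
by rewrite mulr_ge0 ?sqr_ge0 // subr_ge0 ler_sqr ?nnegrE // (le_trans c0).
Qed.

Lemma spectral_quotient_lt d (c : R) p : 0 <= c ->
  (forall i, 0 <= lambda 0 i <= c) -> lambda 0 p < c -> d p 0 != 0 ->
  spectral_quotient d < c.
Proof.
move=> c0 cl clp dp.
have d0 : d != 0 by apply: contra_neq dp => ->; rewrite mxE.
have l0 i : 0 <= lambda 0 i by have /andP[] := cl i.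
rewrite -(@ltr_sqr _ _ c) ?nnegrE ?spectral_quotient_ge0 //.
rewrite -subr_lt0 -(pmulr_llt0 _ (exprn_gt0 2 (enorm_gt0 d0))).
rewrite spectral_quotient_sqrB // -oppr_gt0 -sumrN (bigD1 p) //= ltr_pwDl //.
  rewrite -mulNr opprB.
  rewrite mulr_gt0 ?subr_gt0 ?lt0r ?sqrf_eq0 ?dp ?sqr_ge0 //.
  by rewrite ltr_sqr ?nnegrE.
rewrite sumr_ge0 // => i _; rewrite -mulNr opprB.
rewrite mulr_ge0 ?sqr_ge0 // subr_ge0 ler_sqr ?nnegrE //.
by have /andP[] := cl i.
Qed.

(** Factor [q ^+ 2 - c ^+ 2] as [(q - c) * (q + c)], with [q + c >= c] and
    [enorm d ^+ 2 >= d p 0 ^+ 2]. Indices sharing the eigenvalue of [p] drop out of the sum, so only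
    the other ratios must be shown to vanish. *)
Lemma spectral_quotient_dist d (p : 'I_n) : 0 < lambda 0 p -> d p 0 != 0 ->
  `|spectral_quotient d - lambda 0 p| <=
  (lambda 0 p)^-1 * \sum_(i < n)
    `|lambda 0 i ^+ 2 - lambda 0 p ^+ 2| * (d i 0 / d p 0) ^+ 2.
Proof.
set c := lambda 0 p => c0 dp.
have d0 : d != 0 by apply: contra_neq dp => ->; rewrite mxE.
have q0 := spectral_quotient_ge0 d; set q := spectral_quotient d in q0 *.
have dp2 : 0 < d p 0 ^+ 2 by rewrite lt0r sqrf_eq0 dp sqr_ge0.
have le_dp : d p 0 ^+ 2 <= enorm d ^+ 2.
  rewrite sqr_enorm (bigD1 p) //= lerDl sumr_ge0 // => i _; exact: sqr_ge0.
rewrite mulrC ler_pdivlMr // -(ler_pM2r dp2) mulr_suml.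
apply: (@le_trans _ _ (`|(q ^+ 2 - c ^+ 2) * enorm d ^+ 2|)).
  rewrite normrM (ger0_norm (sqr_ge0 (enorm d))) subr_sqr normrM.
  have cq : c <= `|q + c| by rewrite ger0_norm ?lerDr // addr_ge0 // ltW.
  by apply: ler_pM; rewrite ?sqr_ge0 ?mulr_ge0 ?ler_wpM2l ?(ltW c0).
rewrite spectral_quotient_sqrB // (le_trans (ler_norm_sum _ _ _)) //.
rewrite ler_sum // => i _.
by rewrite normrM (ger0_norm (sqr_ge0 _)) -mulrA -exprMn divfK.
Qed.

End SpectralQuotient.

(** * Monotonicity and bounds of the running estimators *)

Section Estimators.
Set Implicit Arguments.
Unset Strict Implicit.
Variables (R : realType) (n : nat) (lambda : 'rV[R]_n).
Variables (xi : nat -> 'cV[R]_n).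
Local Notation Lam := (diag_mx lambda).

Lemma local_curvE k :
  local_curv Lam xi k = spectral_quotient lambda (xi k - xi k.-1).
Proof. by rewrite /local_curv /quad_grad -mulmxBr. Qed.

Lemma LhatSS k : Lhat Lam xi k.+2 =
  if xi k.+2 == xi k.+1 then Lhat Lam xi k.+1
  else Num.max (Lhat Lam xi k.+1) (local_curv Lam xi k.+2).
Proof. by []. Qed.

Lemma Lhat_nondecreasing : nondecreasing_seq (Lhat Lam xi).
Proof.
(* The values at 0 and 1 are both [local_curv Lam xi 1], so monotonicity already holds from index
   0. *)
apply/nondecreasing_seqP => -[|k]; first by [].
by rewrite LhatSS; case: ifP => // _; rewrite le_max lexx.
Qed.

Lemma muhatSS k : muhat Lam xi k.+2 =
  if xi k.+2 == xi k.+1 then muhat Lam xi k.+1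
  else Num.min (muhat Lam xi k.+1) (local_curv Lam xi k.+2).
Proof. by []. Qed.

Lemma muhat_nonincreasing : nonincreasing_seq (muhat Lam xi).
Proof.
apply/nonincreasing_seqP => -[|k]; first by [].
by rewrite muhatSS; case: ifP => // _; rewrite ge_min lexx.
Qed.

Lemma local_curv_le_Lhat k : xi k.+1 != xi k ->
  local_curv Lam xi k.+1 <= Lhat Lam xi k.+1.
Proof. by case: k => [|k] // /negbTE xk; rewrite LhatSS xk le_max lexx orbT. Qed.

Lemma muhat_le_local_curv k : xi k.+1 != xi k ->
  muhat Lam xi k.+1 <= local_curv Lam xi k.+1.
Proof. by case: k => [|k] // /negbTE xk; rewrite muhatSS xk ge_min lexx orbT. Qed.

Lemma Lhat_le (c : R) k : xi 1%N != xi 0%N ->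
  (forall i, 0 <= lambda 0 i <= c) -> 0 <= c -> Lhat Lam xi k <= c.
Proof.
move=> x1 cl c0.
have curv j : xi j.+1 != xi j -> local_curv Lam xi j.+1 <= c.
  by move=> xj; rewrite local_curvE spectral_quotient_le // subr_eq0.
elim: k => [|[|k] IH]; try exact: curv.
rewrite LhatSS; case: ifPn => // xk.
by rewrite ge_max IH curv.
Qed.

(** The first estimate has no guard against 0 / 0, hence the hypothesis on the first step; later
    degenerate steps leave the estimator unchanged. *)
Lemma muhat_ge (c : R) k : xi 1%N != xi 0%N ->
  (forall i, c <= lambda 0 i) -> 0 <= c -> c <= muhat Lam xi k.
Proof.
move=> x1 cl c0.
have curv j : xi j.+1 != xi j -> c <= local_curv Lam xi j.+1.
  by move=> xj; rewrite local_curvE spectral_quotient_ge // subr_eq0.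
elim: k => [|[|k] IH]; try exact: curv.
rewrite muhatSS; case: ifPn => // xk.
by rewrite le_min IH curv.
Qed.

End Estimators.

(** * Coordinatewise dynamics and the limit of the curvature estimate *)

Section GradientDescent.
Set Implicit Arguments.
Unset Strict Implicit.
Variables (R : realType) (n : nat) (lambda : 'rV[R]_n).
Variables (alpha : nat -> R) (xi : nat -> 'cV[R]_n).
Local Notation Lam := (diag_mx lambda).
Hypothesis xiS : forall k, xi k.+1 = (1%:M - alpha k *: Lam) *m xi k.

Lemma gd_coord k i : xi k.+1 i 0 = (1 - alpha k * lambda 0 i) * xi k i 0.
Proof.
rewrite xiS mulmxBl mul1mx -scalemxAl mul_diag_mx !mxE; ring.
Qed.

Lemma gd_step k i : (xi k.+1 - xi k) i 0 = - (alpha k * lambda 0 i * xi k i 0).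
Proof. by rewrite !mxE gd_coord; ring. Qed.

Lemma gd_coord_neq0 i : xi 0%N i 0 != 0 ->
  (forall k, alpha k * lambda 0 i != 1) -> forall k, xi k i 0 != 0.
Proof.
move=> x0 al; elim=> // k IH.
by rewrite gd_coord mulf_neq0 // subr_eq0 eq_sym.
Qed.

(* The slowest-contracting coordinates dominate the displacement. *)
Lemma local_curv_cvg (a : R) (p : 'I_n) : 0 < lambda 0 p ->
  (forall k, 0 < alpha k) -> (forall k, xi k p 0 != 0) ->
  alpha k @[k --> \oo] --> a ->
  (forall i, lambda 0 i != lambda 0 p ->
     `|1 - a * lambda 0 i| < `|1 - a * lambda 0 p|) ->
  local_curv Lam xi k.+1 @[k --> \oo] --> lambda 0 p.
Proof.
move=> lp al xp cva dom.
pose b k i := `|lambda 0 i ^+ 2 - lambda 0 p ^+ 2| *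
  ((xi k.+1 - xi k) i 0 / (xi k.+1 - xi k) p 0) ^+ 2.
have b0 i : b k i @[k --> \oo] --> (0 : R).
  have [lip|lip] := eqVneq (lambda 0 i) (lambda 0 p).
    rewrite (_ : b ^~ i = fun=> 0); first exact: cvg_cst.
    by apply/funext => k; rewrite /b lip subrr normr0 mul0r.
  (* Each step multiplies this ratio by a quotient of contraction factors, whose limit has modulus
     below 1 by [dom]. *)
  pose r k := xi k i 0 / xi k p 0.
  have r0 : r k @[k --> \oo] --> (0 : R).
    have ap : 1 - a * lambda 0 p != 0.
      by rewrite -normr_gt0 (le_lt_trans _ (dom i lip)).
    have cvl j : (1 - alpha k * lambda 0 j) @[k --> \oo] --> 1 - a * lambda 0 j.
      by apply: cvgB; [exact: cvg_cst | exact: cvgMr_tmp].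
    apply: (@cvg0_ratio _ r
      (fun k => (1 - alpha k * lambda 0 i) / (1 - alpha k * lambda 0 p))
      ((1 - a * lambda 0 i) / (1 - a * lambda 0 p))).
    - by move=> k; rewrite /r !gd_coord mulf_div.
    - by apply: cvgM => //; apply: cvgV.
    - by rewrite normrM normfV ltr_pdivrMr ?normr_gt0 // mul1r dom.
  (* The stepsize cancels in the ratio of two displacement coordinates, leaving [r k] times a ratio
     of eigenvalues. *)
  pose C := `|lambda 0 i ^+ 2 - lambda 0 p ^+ 2| * (lambda 0 i / lambda 0 p) ^+ 2.
  rewrite (_ : b ^~ i = fun k => C * (r k * r k)); last first.
    apply/funext => k; rewrite /b /C /r !gd_step.
    have := lt0r_neq0 (al k); have := lt0r_neq0 lp; have := xp k.
    by move=> *; field; apply/and3P.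
  rewrite -[X in _ --> X](mulr0 C); apply: cvgMl_tmp.
  by rewrite -[X in _ --> X](mulr0 0); apply: cvgM.
have lem : local_curv Lam xi k.+1 - lambda 0 p @[k --> \oo] --> (0 : R).
  apply/norm_cvg0P.
  apply: (@squeeze_cvgr _ _ _ _ (cst 0)
           (fun k => (lambda 0 p)^-1 * \sum_(i < n) b k i)).
  - apply: nearW => k; rewrite normr_ge0 local_curvE /=.
    apply: spectral_quotient_dist => //.
    by rewrite gd_step oppr_eq0 !mulf_neq0 // gt_eqF.
  - exact: cvg_cst.
  - rewrite -[X in _ --> X](mulr0 (lambda 0 p)^-1); apply: cvgMl_tmp.
    have s0 : \sum_(i < n) 0 = 0 :> R by rewrite big1.
    rewrite -[X in _ --> X]s0.
    exact: (cvg_big add_continuous _ (fun i _ => b0 i)).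
exact/subr_cvg0.
Qed.
End GradientDescent.

(** * Limits of the estimators and of the stepsizes *)

Theorem theorem8 (R : realType) (n : nat) (lambda : 'rV[R]_n.+1)
    (alpha : nat -> R) (xi : nat -> 'cV[R]_n.+1)
    (mu := lambda 0 ord0) (L := lambda 0 ord_max) (Lam := diag_mx lambda)
    (mu_gt0 : 0 < mu)
    (lambda_le : forall i j : 'I_n.+1, (i <= j)%N -> lambda 0 i <= lambda 0 j)
    (alpha0_gt0 : 0 < alpha 0%N)
    (alpha0_generic : mu < L -> alpha 0%N <> mu^-1 /\ alpha 0%N <> L^-1)
    (xi0_neq0 : forall i : 'I_n.+1, xi 0%N i 0 <> 0)
    (xiS : forall k : nat, xi k.+1 = (1%:M - alpha k *: Lam) *m xi k)
    (alphaE : forall k : nat, (1 <= k)%N ->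
      alpha k = 2 / (muhat Lam xi k + Lhat Lam xi k)) :
  alpha k @[k --> \oo] --> 2 / (L + mu).
Proof.
have mul i : mu <= lambda 0 i by apply: lambda_le.
have lL i : lambda 0 i <= L by apply: lambda_le; rewrite -ltnS.
have l0 i : 0 < lambda 0 i by apply: lt_le_trans (mul i).
have L0 : 0 < L by exact: l0.
have muL : mu <= L by exact: mul.
have x0 i : xi 0%N i 0 != 0 by apply/eqP.
have d1 i : (xi 1%N - xi 0%N) i 0 != 0.
  rewrite (gd_step xiS) oppr_eq0 !mulf_neq0 //.
    by rewrite gt_eqF.
  by rewrite gt_eqF.
have x1 : xi 1%N != xi 0%N.
  by rewrite -subr_eq0; apply: contraNneq (d1 ord0) => ->; rewrite mxE.
have mh_ge k : mu <= muhat Lam xi k by rewrite muhat_ge // ltW.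
have Lh_le k : Lhat Lam xi k <= L.
  by apply: Lhat_le => //; [move=> i; rewrite lL ltW | exact: ltW].
pose l1 := local_curv Lam xi 1.
have mh_le k : muhat Lam xi k <= l1 by exact: (muhat_nonincreasing _ _ (leq0n k)).
have Lh_ge k : l1 <= Lhat Lam xi k by exact: (Lhat_nondecreasing _ _ (leq0n k)).
have [m cvm] : exists m : R, muhat Lam xi k @[k --> \oo] --> m.
  exists (limn (muhat Lam xi)); apply: nonincreasing_is_cvgn;
    first exact: muhat_nonincreasing.
  by exists mu => _ [k _ <-].
have [M cvM] : exists M : R, Lhat Lam xi k @[k --> \oo] --> M.
  exists (limn (Lhat Lam xi)); apply: nondecreasing_is_cvgn;
    first exact: Lhat_nondecreasing.
  by exists L => _ [k _ <-].
have mum : mu <= m by apply: (cvgr_to_ge cvm); apply: nearW.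
have ml1 : m <= l1 by apply: (cvgr_to_le cvm); apply: nearW.
have l1M : l1 <= M by apply: (cvgr_to_ge cvM); apply: nearW.
have ML : M <= L by apply: (cvgr_to_le cvM); apply: nearW.
have mM0 : 0 < m + M by lra.
have cva : alpha k @[k --> \oo] --> 2 / (m + M).
  (* The stepsize law starts at index 1, so the free value [alpha 0] is shifted away. *)
  rewrite -cvg_shiftS.
  under eq_fun do rewrite alphaE //.
  apply: cvgMl_tmp; apply: cvgV; first by rewrite gt_eqF.
  rewrite (cvg_shiftS (fun k => muhat Lam xi k + Lhat Lam xi k)).
  exact: cvgD.
suff <- : m + M = L + mu by [].
(* If [mu = L], the chain [mu <= m <= l1 <= M <= L] collapses. *)
have [muLE|muL'] := eqVneq mu L; first lra.
have {}muL' : mu < L by rewrite lt_neqAle muL'.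
have mul1 : mu < l1.
  rewrite /l1 local_curvE; apply: (@spectral_quotient_gt _ _ _ _ _ ord_max) => //.
  exact: ltW.
have l1L : l1 < L.
  rewrite /l1 local_curvE; apply: (@spectral_quotient_lt _ _ _ _ _ ord0) => //.
    exact: ltW.
  by move=> i; rewrite lL ltW.
have a0 k : 0 < alpha k.
  case: k => // k; rewrite alphaE // divr_gt0 //.
  by have := mh_ge k.+1; have := Lh_ge k.+1; lra.
(* Genericity covers step 0. Later, [alpha k * mu = 1] would make the two estimators sum to
   [2 * mu], although [muhat >= mu] and [Lhat >= l1 > mu]. *)
have xmu k : xi k ord0 0 != 0.
  apply: (gd_coord_neq0 xiS) => // {}k; case: k => [|k].
    have [al _] := alpha0_generic muL'.
    apply/eqP => E; apply: al; rewrite -[LHS](mulfK (lt0r_neq0 mu_gt0)) E.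
    by rewrite mul1r.
  rewrite alphaE // -mulrAC; apply/eqP.
  have H1 := mh_ge k.+1; have H2 := Lh_ge k.+1.
  move/divr1_eq; rewrite -/mu; lra.
have xL k : xi k ord_max 0 != 0.
  apply: (gd_coord_neq0 xiS) => // {}k; case: k => [|k].
    have [_ al] := alpha0_generic muL'.
    apply/eqP => E; apply: al; rewrite -[LHS](mulfK (lt0r_neq0 L0)) E.
    by rewrite mul1r.
  rewrite alphaE // -mulrAC; apply/eqP.
  have H1 := mh_le k.+1; have H2 := Lh_le k.+1.
  move/divr1_eq; rewrite -/L; lra.
(* Thus no step is degenerate, and every [local_curv] lies between the two estimators. *)
have xS k : xi k.+1 != xi k.
  rewrite -subr_eq0; apply: contra_neq (xmu k) => /matrixP/(_ ord0 0).
  rewrite (gd_step xiS) mxE => /eqP.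
  by rewrite oppr_eq0 !mulf_eq0 (gt_eqF (a0 k)) (gt_eqF (l0 _)) => /eqP.
have aE : 2 / (m + M) * (m + M) = 2 by rewrite divfK // gt_eqF.
set a := 2 / (m + M) in cva aE.
have a_gt0 : 0 < a by rewrite divr_gt0.
apply/eqP; rewrite eq_le; apply/andP; split; rewrite leNgt; apply/negP => mM.
- have cvl : local_curv Lam xi k.+1 @[k --> \oo] --> mu.
    apply: (local_curv_cvg xiS (l0 _) a0 xmu cva) => i.
    rewrite -/mu => li.
    have {}li : mu < lambda 0 i by rewrite lt_neqAle eq_sym li mul.
    have H1 : a * mu < a * lambda 0 i by rewrite ltr_pM2l.
    have H2 : a * lambda 0 i <= a * L by rewrite ler_pM2l.
    have H3 : a * (L + mu) < 2 by rewrite -aE ltr_pM2l.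
    (* Since [a * (L + mu) < 2], the factor [1 - a * mu] is positive and exceeds [a * L - 1], hence
       also [a * lambda 0 i - 1]. *)
    by rewrite [ltRHS]gtr0_norm ?ltr_norml; [apply/andP; split|]; lra.
  suff : m <= mu by lra.
  rewrite -cvg_shiftS in cvm.
  apply: (ler_cvg_to cvm cvl); apply: nearW => k.
  exact: muhat_le_local_curv.
- have cvl : local_curv Lam xi k.+1 @[k --> \oo] --> L.
    apply: (local_curv_cvg xiS (l0 _) a0 xL cva) => i.
    rewrite -/L => li.
    have {}li : lambda 0 i < L by rewrite lt_neqAle li lL.
    have H1 : a * lambda 0 i < a * L by rewrite ltr_pM2l.
    have H2 : a * mu <= a * lambda 0 i by rewrite ler_pM2l.
    have H3 : 2 < a * (L + mu) by rewrite -aE ltr_pM2l.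
    (* Now [1 - a * L] is negative, and its modulus [a * L - 1] exceeds [1 - a * mu]. *)
    by rewrite [ltRHS]ltr0_norm ?ltr_norml; [apply/andP; split|]; lra.
  suff : L <= M by lra.
  rewrite -cvg_shiftS in cvM.
  apply: (ler_cvg_to cvl cvM); apply: nearW => k.
  exact: local_curv_le_Lhat.
Qed.
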